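(* Let $A=\mathcal{P}_\Omega(M+X)$ be the observed matrix with $M\in[0,1]^{m\times n}$ and sampling rate $\delta$, its columns being presented in uniformly random order. Assume: (i) $\|M\|_F^2=\Theta(mn)$; (ii) there exists $i\le\min(n,m)$ such that $\frac{s_i(M)}{s_{i+1}(M)}=\omega(1)$ and $\sum_{j=i+1}^{\min(m,n)}s_j^2(M)=o(mn)$, and $k$ denotes the smallest such $i$; (iii) $\delta=\omega\left(k\max\left(\frac1n,\frac{\log^2 m}{m}\right)\right)$ and $\delta=o\left(\frac{1}{\log^2 m}\right)$. When $\ell=\frac{k}{\delta\log(m)}$, the memory required to run the one-pass algorithm SMC with parameters $k$ and $\ell$ is, with high probability, $O(km+kn)$.
   Context: Asymptotics: $m,n\to\infty$, and all other quantities ($\delta$, $k$, $\ell$, $M$, ...) may depend on $m,n$; $o,O,\omega,\Omega,\Theta$ refer to this limit, and ''with high probability'' means with probability tending to $1$. Memory model: sparse matrices are stored through their non-zero entries only, each requiring its value and its id (position), the id costing $O(\log m)$; each entry of a dense matrix costs $O(1)$. Memory freed by removing objects may be reused. The output of the algorithm is stored as the pair of factors $\hat U$ ($m\times k$) and $\hat V$ ($n\times k$). Notation: $A^\dagger$ is the transpose; $s_1(A)\ge s_2(A)\ge\dots$ are singular values; $\|\cdot\|_F$ is the Frobenius norm. $A_i$ and $A^j$ are the $i$-th column and $j$-th row of $A$; $A^{a:b}$ is the submatrix of rows $a,\dots,b$. Observation model: $X$ has independent zero-mean entries with $M_{ij}+X_{ij}\in[0,1]$. Each entry belongs to the random set $\Omega$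 independently with probability $\delta$; $[\mathcal{P}_\Omega(Y)]_{ij}=Y_{ij}$ if $(i,j)\in\Omega$ and $0$ otherwise. Streaming model: columns of $A$ arrive one at a time, each arriving column being uniformly distributed among those not yet observed; columns of $A$ are indexed in order of arrival. Once discarded, a column cannot be requested again. SPCA (input $B\in[0,1]^{m\times\ell}$, $k$): $\hat\delta_B\leftarrow\frac{1}{m\ell}\sum_{(i,j)}1(B_{ij}>0)$; $\tilde B\leftarrow B$ with rows having more than $\max\{10,10\hat\delta_B\ell\}$ non-zero entries erased; $\Phi\leftarrow\tilde B^\dagger\tilde B-\mathrm{diag}(\tilde B^\dagger\tilde B)$; start from a random $\ell\times k$ matrix $Q^{(0)}$ with orthonormal columns, and for $\tau=1,\dots,\lceil10\log\ell\rceil$ let $Q^{(\tau)}R^{(\tau)}$ be the QR decomposition of $\Phi Q^{(\tau-1)}$; output the last $Q^{(\tau)}$. Split$(B,a,b,\delta')$: creates $B^{(1)},\dots,B^{(a)}$, initially zero matrices of the size of $B$. For each entry $(u,v)$ independently, a random subset $\gamma\subset\{1,\dots,b\}$ is drawn, equal to a non-empty $s$ with probability $\frac{1}{\delta'}(\frac{\delta'}{b})^{|s|}(1-\frac{\delta'}{b})^{b-|s|}$ and empty with probability $1-\frac{1}{\delta'}(1-(1-\frac{\delta'}{b})^b)$; then $[B^{(i)}]_{uv}\leftarrow B_{uv}$ for every $i\in\gamma$ (with $i\le a$). In the analysis, the outputs with $b=4$ are regarded as independent given $M+X$, each distributed as the original sampled matrix with $\delta$ replaced by $\delta/4$. SMC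 (parameters $k,\ell$): (1) $A^{(B)}=[A_1,\dots,A_\ell]$; (2) $\hat\delta=\frac{1}{m\ell}\sum_{(i,j)}1([A^{(B)}]_{ij}>0)$; (3) $A^{(B_1)},\dots,A^{(B_4)}\leftarrow$ Split$(A^{(B)},4,4,\hat\delta)$; (4) $Q\leftarrow$ SPCA$(A^{(B_1)},k)$; (5) in $A^{(B_2)}$, set to zero the rows having more than two observed entries, then set to zero the columns having more than $10m\hat\delta$ non-zero entries; (6) $W\leftarrow A^{(B_2)}Q$; (7) $\hat V^{1:\ell}\leftarrow(A^{(B_3)})^\dagger W$; (8) $\hat I\leftarrow A^{(B_4)}\hat V^{1:\ell}$; then remove the batch $A^{(B)}$, its subsampled copies and $Q$ from memory; for each $t=\ell+1,\dots,n$: (9) $A_t^{(1)},A_t^{(2)}\leftarrow$ Split$(A_t,2,4,\hat\delta)$; (10) $\hat V^t\leftarrow(A_t^{(1)})^\dagger W$; (11) $\hat I\leftarrow\hat I+A_t^{(2)}\hat V^t$, then remove $A_t$ and its copies from memory; finally (12) using the Gram-Schmidt process find a $k\times k$ matrix $\hat R$ such that $\hat V\hat R$ has orthonormal columns, where $\hat V$ is the $n\times k$ matrix with rows $\hat V^1,\dots,\hat V^n$; (13) $\hat U\leftarrow\frac{4}{\hat\delta}\hat I\hat R\hat R^\dagger$. *)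

(* Defs.v *)
From HB Require Import structures.
From mathcomp Require Import all_boot all_order all_algebra all_fingroup.
From mathcomp Require Import all_classical all_reals all_analysis.
From mathcomp Require polyrcf.

Set Implicit Arguments.
Unset Strict Implicit.
Unset Printing Implicit Defensive.

Import Order.TTheory GRing.Theory Num.Theory.
Import numFieldNormedType.Exports.

Local Open Scope classical_set_scope.
Local Open Scope ring_scope.

Definition frobenius_sq (R : realType) (p q : nat) (A : 'M[R]_(p, q)) : R :=
  \sum_i \sum_j A i j ^+ 2.

(* [rootsR] lists the distinct real roots in increasing order; each eigenvalue
   of A^T A is repeated according to its algebraic multiplicity. *)
Definition singular_values (R : realType) (p q : nat) (A : 'M[R]_(p, q))
    : seq R :=
  let f := char_poly (A^T *m A) in
  rev (flatten [seq nseq (mup x f) (Num.sqrt x) | x <- polyrcf.rootsR f]).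

(* Indexed from 1; equal to 0 beyond q, and also (as a singular value) between
   min(p, q) and q. *)
Definition sval (R : realType) (p q : nat) (A : 'M[R]_(p, q)) (i : nat) : R :=
  (singular_values A)`_i.-1.

Definition row_nnz (R : realType) (p q : nat) (A : 'M[R]_(p, q)) (i : 'I_p) :=
  #|[pred j | A i j != 0]|.

Definition nnz (R : realType) (p q : nat) (A : 'M[R]_(p, q)) : nat :=
  \sum_i row_nnz A i.

Definition density (R : realType) (p q : nat) (A : 'M[R]_(p, q)) : R :=
  #|[pred u : 'I_p * 'I_q | 0 < A u.1 u.2]|%:R / (p * q)%:R.

Definition erase_rows (R : realType) (p q : nat) (c : R) (A : 'M[R]_(p, q)) :=
  \matrix_(i, j) (if c < (row_nnz A i)%:R then 0 else A i j).

Definition erase_cols (R : realType) (p q : nat) (c : R) (A : 'M[R]_(p, q)) :=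
  (erase_rows c A^T)^T.

(* The submatrix A^{1:a}, padded with zero rows if a > p. *)
Definition first_rows (R : realType) (p q a : nat) (A : 'M[R]_(p, q))
    : 'M[R]_(a, q) :=
  \matrix_(i, j) (if insub (i : nat) is Some i' then A i' j else 0).

Definition first_cols (R : realType) (p q a : nat) (A : 'M[R]_(p, q))
    : 'M[R]_(p, a) := (first_rows a A^T)^T.

Inductive stored (R : realType) : Type :=
| Sparse (p q : nat) of 'M[R]_(p, q)
| Dense (p q : nat) of 'M[R]_(p, q).
Arguments Sparse {R p q} _.
Arguments Dense {R p q} _.

(* A scalar costs [cval]; the id of a sparse entry costs [cid * log m]. *)
Definition stored_size (R : realType) (cval cid : R) (m : nat) (o : stored R)
    : R :=
  match o with
  | Sparse p q A => (nnz A)%:R * (cval + cid * ln m%:R)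
  | Dense p q _ => (p * q)%:R * cval
  end.

(* A trace lists the successive contents of the memory. *)
Definition trace (R : realType) := seq (seq (stored R)).

Definition peak_memory (R : realType) (cval cid : R) (m : nat) (t : trace R)
    : R :=
  \big[Num.max/0]_(st <- t) \sum_(o <- st) stored_size cval cid m o.

(* QR decompositions are not unique when the rank is deficient, hence abstract
   subroutines. *)
Record subroutines (R : realType) := Subroutines {
  qr : forall p q : nat, 'M[R]_(p, q) -> 'M[R]_(p, q) * 'M[R]_q;
  gram_schmidt : forall p q : nat, 'M[R]_(p, q) -> 'M[R]_q }.

Definition orthonormal_cols (R : realType) (p q : nat) (A : 'M[R]_(p, q)) :=
  A^T *m A = 1%:M.

Definition upper_triangular (R : realType) (q : nat) (A : 'M[R]_q) :=
  is_trig_mx A^T.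

(* The guards are the conditions under which the required output exists. *)
Definition subroutines_correct (R : realType) (sub : subroutines R) : Prop :=
  (forall (p q : nat) (A : 'M[R]_(p, q)), (q <= p)%N ->
     [/\ A = (qr sub A).1 *m (qr sub A).2,
         orthonormal_cols (qr sub A).1 & upper_triangular (qr sub A).2]) /\
  (forall (p q : nat) (A : 'M[R]_(p, q)), \rank A = q ->
     orthonormal_cols (A *m gram_schmidt sub A) /\
     upper_triangular (gram_schmidt sub A)).

Definition spca_trim (R : realType) (m l : nat) (B : 'M[R]_(m, l)) :=
  erase_rows (Num.max 10 (10 * density B * l%:R)) B.

Definition spca_diag (R : realType) (m l : nat) (B : 'M[R]_(m, l))
    : 'rV[R]_l :=
  \row_j ((spca_trim B)^T *m spca_trim B) j j.

Definition spca_Phi (R : realType) (m l : nat) (B : 'M[R]_(m, l)) : 'M[R]_l :=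
  (spca_trim B)^T *m spca_trim B - diag_mx (spca_diag B).

Definition spca_steps (R : realType) (l : nat) : nat :=
  absz (Num.ceil (10 * ln (l%:R : R))).

Definition spca_iter (R : realType) (sub : subroutines R) (m l k : nat)
    (B : 'M[R]_(m, l)) (Q0 : 'M[R]_(l, k)) (tau : nat) : 'M[R]_(l, k) :=
  iter tau (fun Q => (qr sub (spca_Phi B *m Q)).1) Q0.

Definition spca (R : realType) (sub : subroutines R) (m l k : nat)
    (B : 'M[R]_(m, l)) (Q0 : 'M[R]_(l, k)) : 'M[R]_(l, k) :=
  spca_iter sub B Q0 (spca_steps R l).

(* Working memory of SPCA, on top of its input.  The matrix Phi is used as an
   operator and is not stored: with Bt the trimmed matrix and D the diagonal
   of Bt^T Bt, the product Phi Q is computed as Bt^T (Bt Q) - diag(D) Q. *)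
Definition spca_trace (R : realType) (sub : subroutines R) (m l k : nat)
    (B : 'M[R]_(m, l)) (Q0 : 'M[R]_(l, k)) : trace R :=
  let dB := Dense (const_mx (density B) : 'M[R]_1) in
  let Bt := spca_trim B in
  let D := Dense (spca_diag B) in
  [:: [:: dB]; [:: dB; Sparse Bt]; [:: dB; Sparse Bt; D];
      [:: dB; Sparse Bt; D; Dense Q0]] ++
  flatten
    [seq (let Q := spca_iter sub B Q0 tau in
          let Y := spca_Phi B *m Q in
          [:: [:: dB; Sparse Bt; D; Dense Q; Dense (Bt *m Q)];
              [:: dB; Sparse Bt; D; Dense Q; Dense (Bt *m Q); Dense Y];
              [:: dB; Sparse Bt; D; Dense Y;
                  Dense (qr sub Y).1; Dense (qr sub Y).2]])
    | tau <- iota 0 (spca_steps R l)].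

(* [split_prob b d s] is the probability that an entry is copied exactly to
   the matrices indexed by s; it is the point mass at [set0] if d = 0. *)
Definition split_prob (R : realType) (b : nat) (d : R) (s : {set 'I_b}) : R :=
  if s == finset.set0 then 1 - d^-1 * (1 - (1 - d / b%:R) ^+ b)
  else d^-1 * (d / b%:R) ^+ #|s| * (1 - d / b%:R) ^+ (b - #|s|).

(* Output i of Split (numbered from 1) for the drawn subsets g. *)
Definition split_part (R : realType) (p q : nat)
    (g : 'M[{set 'I_4}]_(p, q)) (i : nat) (B : 'M[R]_(p, q)) : 'M[R]_(p, q) :=
  \matrix_(u, v) (if inord i.-1 \in g u v then B u v else 0).

(* The columns of [stream] are in order of arrival; [gbatch] and [gstream]
   are the subsets drawn by Split for the batch and for each later column
   (only the columns of [gstream] from index l on are used); [spca_start] is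
   the initial matrix of SPCA. *)
Record smc_input (R : realType) (m n l k : nat) := SMCInput {
  stream : 'M[R]_(m, n);
  gbatch : 'M[{set 'I_4}]_(m, l);
  gstream : 'M[{set 'I_4}]_(m, n);
  spca_start : 'M[R]_(l, k) }.

Definition smc_batch (R : realType) (m n l k : nat) (x : smc_input R m n l k)
    : 'M[R]_(m, l) := first_cols l (stream x).

Definition smc_density (R : realType) (m n l k : nat)
    (x : smc_input R m n l k) : R := density (smc_batch x).

Definition smc_B (R : realType) (m n l k : nat) (x : smc_input R m n l k)
    (i : nat) : 'M[R]_(m, l) := split_part (gbatch x) i (smc_batch x).

Definition smc_Q (R : realType) (sub : subroutines R) (m n l k : nat)
    (x : smc_input R m n l k) : 'M[R]_(l, k) := spca sub (smc_B x 1) (spca_start x).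

Definition smc_B2_rows (R : realType) (m n l k : nat)
    (x : smc_input R m n l k) : 'M[R]_(m, l) := erase_rows 2 (smc_B x 2).

Definition smc_B2_cols (R : realType) (m n l k : nat)
    (x : smc_input R m n l k) : 'M[R]_(m, l) :=
  erase_cols (10 * m%:R * smc_density x) (smc_B2_rows x).

Definition smc_W (R : realType) (sub : subroutines R) (m n l k : nat)
    (x : smc_input R m n l k) : 'M[R]_(m, k) := smc_B2_cols x *m smc_Q sub x.

Definition smc_Vbatch (R : realType) (sub : subroutines R) (m n l k : nat)
    (x : smc_input R m n l k) : 'M[R]_(l, k) := (smc_B x 3)^T *m smc_W sub x.

Definition smc_A (R : realType) (m n l k : nat) (x : smc_input R m n l k)
    (i : nat) (t : 'I_n) : 'cV[R]_m :=
  split_part (col t (gstream x)) i (col t (stream x)).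

Definition smc_V (R : realType) (sub : subroutines R) (m n l k : nat)
    (x : smc_input R m n l k) : 'M[R]_(n, k) :=
  \matrix_(t, c) (if insub (t : nat) is Some j then smc_Vbatch sub x j c
                  else ((smc_A x 1 t)^T *m smc_W sub x) ord0 c).

(* The accumulator I after the first t columns have been processed. *)
Definition smc_I (R : realType) (sub : subroutines R) (m n l k : nat)
    (x : smc_input R m n l k) (t : nat) : 'M[R]_(m, k) :=
  smc_B x 4 *m smc_Vbatch sub x +
  \sum_(u < n | (l <= u < t)%N) smc_A x 2 u *m row u (smc_V sub x).

Definition smc_R (R : realType) (sub : subroutines R) (m n l k : nat)
    (x : smc_input R m n l k) : 'M[R]_k := gram_schmidt sub (smc_V sub x).

Definition smc_U (R : realType) (sub : subroutines R) (m n l k : nat)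
    (x : smc_input R m n l k) : 'M[R]_(m, k) :=
  (4 / smc_density x) *: (smc_I sub x n *m smc_R sub x *m (smc_R sub x)^T).

(* The result of an assignment is written to fresh memory while the operands
   are still present. *)
Definition smc_trace (R : realType) (sub : subroutines R) (m n l k : nat)
    (x : smc_input R m n l k) : trace R :=
  let AB := Sparse (smc_batch x) in
  let d := Dense (const_mx (smc_density x) : 'M[R]_1) in
  let B i := Sparse (smc_B x i) in
  let Q := Dense (smc_Q sub x) in
  let W := Dense (smc_W sub x) in
  let V := smc_V sub x in
  let I t := Dense (smc_I sub x t) in
  let Rh := smc_R sub x in
  let s3 := [:: AB; d; B 1; B 2; B 3; B 4] in
  let s4 := rcons s3 Q in
  let s5 := s4 ++ [:: Sparse (smc_B2_rows x); Sparse (smc_B2_cols x)] in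
  let s6 := rcons s5 W in
  let s7 := rcons s6 (Dense (smc_Vbatch sub x)) in
  let s8 := rcons s7 (I l) in
  let loop (t : 'I_n) :=
    let Vt := Dense (first_rows t V) in
    let Vt1 := Dense (first_rows t.+1 V) in
    let At := Sparse (col t (stream x)) in
    let A1 := Sparse (smc_A x 1 t) in
    let A2 := Sparse (smc_A x 2 t) in
    [:: [:: d; W; Vt; I t; At];
        [:: d; W; Vt; I t; At; A1; A2];
        [:: d; W; Vt1; I t; At; A1; A2];
        [:: d; W; Vt1; I t; At; A1; A2; I t.+1];
        [:: d; W; Vt1; I t.+1]] in
  [:: [:: AB]; [:: AB; d]; s3] ++
  [seq s3 ++ st | st <- spca_trace sub (smc_B x 1) (spca_start x)] ++
  [:: s4; s5; s6; s7; s8; [:: d; W; Dense (first_rows l V); I l]] ++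
  flatten [seq loop t | t : 'I_n <- enum 'I_n & (l <= t)%N] ++
  [:: [:: d; W; Dense V; I n; Dense Rh; Dense (V *m Rh)];
      [:: d; W; Dense V; I n; Dense Rh; Dense (smc_I sub x n *m Rh);
          Dense (smc_U sub x)];
      [:: Dense (smc_U sub x); Dense V]].

Definition proj_obs (R : realType) (m n : nat) (S : 'M[bool]_(m, n))
    (Y : 'M[R]_(m, n)) : 'M[R]_(m, n) :=
  \matrix_(i, j) (if S i j then Y i j else 0).

(* The matrix [P_Omega(M + X)] with its columns in order of arrival: the t-th
   column to arrive is the column [order t]. *)
Definition observed_stream (R : realType) (m n : nat) (M X : 'M[R]_(m, n))
    (S : 'M[bool]_(m, n)) (order : 'S_n) : 'M[R]_(m, n) :=
  col_perm order (proj_obs S (M + X)).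

Definition rv_mx d (T : measurableType d) (R : realType) (P : probability T R)
    (p q : nat) (X : 'I_p -> 'I_q -> {RV P >-> R}) (w : T) : 'M[R]_(p, q) :=
  \matrix_(i, j) X i j w.

Definition noise_model d (T : measurableType d) (R : realType)
    (P : probability T R) (m n : nat) (M : 'M[R]_(m, n))
    (X : 'I_m -> 'I_n -> {RV P >-> R}) : Prop :=
  forall i j, ('E_P[X i j] = 0)%E /\
    {ae P, forall w, 0 <= M i j + X i j w <= 1}.

Definition data_event d (T : measurableType d) (R : realType)
    (P : probability T R) (m n : nat) (X : 'I_m -> 'I_n -> {RV P >-> R})
    (S : T -> 'M[bool]_(m, n)) (order : T -> 'S_n)
    (E : 'I_m -> 'I_n -> set R) (S0 : 'M[bool]_(m, n)) (o : 'S_n) : set T :=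
  [set w | [/\ forall i j, E i j (X i j w), S w = S0 & order w = o]].

(* Mutual independence of the entries of the noise, the indicators of Omega
   (Bernoulli of parameter delta) and the order of arrival (uniform). *)
Definition sampling_law d (T : measurableType d) (R : realType)
    (P : probability T R) (m n : nat) (delta : R)
    (X : 'I_m -> 'I_n -> {RV P >-> R}) (S : T -> 'M[bool]_(m, n))
    (order : T -> 'S_n) : Prop :=
  [/\ forall S0, measurable (S @^-1` [set S0]),
      forall o, measurable (order @^-1` [set o]) &
      forall (E : 'I_m -> 'I_n -> set R) S0 o,
        (forall i j, measurable (E i j)) ->
        P (data_event X S order E S0 o) =
        ((\prod_i \prod_j P (X i j @^-1` E i j)) *
         (\prod_i \prod_j (if S0 i j then delta else 1 - delta))%:E *
         ((n`!%:R)^-1)%:E)%E].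

(* Given the data, every subset used by Split is drawn independently with law
   [split_prob 4 hd], where hd is the empirical density of the batch. *)
Definition split_law d (T : measurableType d) (R : realType)
    (P : probability T R) (m n l : nat) (X : 'I_m -> 'I_n -> {RV P >-> R})
    (S : T -> 'M[bool]_(m, n)) (order : T -> 'S_n) (hd : T -> R)
    (GB : T -> 'M[{set 'I_4}]_(m, l)) (GS : T -> 'M[{set 'I_4}]_(m, n))
    : Prop :=
  [/\ forall g, measurable (GB @^-1` [set g]),
      forall g, measurable (GS @^-1` [set g]) &
      forall (E : 'I_m -> 'I_n -> set R) S0 o c gB gS,
        (forall i j, measurable (E i j)) ->
        P (data_event X S order E S0 o `&` hd @^-1` [set c] `&`
           GB @^-1` [set gB] `&` GS @^-1` [set gS]) =
        (P (data_event X S order E S0 o `&` hd @^-1` [set c]) *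
         (\prod_i \prod_j split_prob c (gB i j))%:E *
         (\prod_i \prod_j split_prob c (gS i j))%:E)%E].

Definition spectral_cut (R : realType) (m n : nat -> nat)
    (M : forall s, 'M[R]_(m s, n s)) (i : nat -> nat) : Prop :=
  [/\ \forall s \near \oo, (1 <= i s <= minn (m s) (n s))%N,
      (* in \bar R the ratio is +oo when only the denominator vanishes *)
      ((sval (M s) (i s))%:E / (sval (M s) (i s).+1)%:E)%E @[s --> \oo]
        --> +oo%E &
      (fun s => \sum_((i s).+1 <= j < (minn (m s) (n s)).+1)
                  sval (M s) j ^+ 2 : R^o)
        =o_\oo (fun s => (m s * n s)%:R : R^o)].

Definition smallest_spectral_cut (R : realType) (m n : nat -> nat)
    (M : forall s, 'M[R]_(m s, n s)) (k : nat -> nat) : Prop :=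
  spectral_cut M k /\
  forall i, spectral_cut M i -> \forall s \near \oo, (k s <= i s)%N.

(* Main.v *)
Require Import Defs.
From HB Require Import structures.
From mathcomp Require Import all_boot all_order all_algebra all_fingroup.
From mathcomp Require Import all_classical all_reals all_analysis.
From mathcomp Require Import measurable_realfun.
From mathcomp Require Import ring lra zify.
Import Order.TTheory GRing.Theory Num.Theory.
Import numFieldNormedType.Exports.
Local Open Scope classical_set_scope.
Local Open Scope ring_scope.

(** Write [L] for [log m].  The dense matrices kept by SMC have sizes [m * k],
    [n * k], [l * k], [k * k] and [l], all [O(k * m + k * n)] because
    [k <= min(m, n)] and [l * delta * L <= 2 * k] with [delta * n >= k] gives
    [l <= 2 * n].  What is random is the size of the sparse matrices: the batch,
    one arriving column at a time, and matrices obtained from these by deleting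
    entries.  An entry costs [O(L)], so it suffices that with high probability
    the batch has [O(k * m / L)] observed entries and every column
    [O((m + n) / L)].

    The observed entries in order of arrival form a matrix of independent
    Bernoulli variables of parameter [delta], whatever the order
    ([arrival_mask_law]).  The batch has mean at most
    [delta * m * l <= 2 * k * m / L], and a column has mean
    [delta * m <= m / L]; variances are bounded by the means.  Chebyshev's
    inequality and a union bound ([mask_count_chebyshev]) bound the probability
    that one of these counts is too large by
    [2 * L / (k * m) + n * m * delta * L ^+ 2 / (m + n) ^+ 2]
    [<= 3 * delta * L ^+ 2], which tends to 0 ([overload_probability]).
    Second moments suffice for the union over [n] columns because the target
    [k * m + k * n] lets a column exceed its mean by [(m + n) / L].

    Off this event the bound is deterministic: at most 12 objects are in memory
    at any time, each of size [O(k * m + k * n)] ([smc_peak_memory_le],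
    [smc_memory_not_overloaded]).

    The event of the theorem has to be measurable for its probability to be
    compared with that of the complementary bad event.  The peak memory depends
    on the noise only through the signs of the entries of [M + X]
    ([peak_memory_same_sign]), hence it is determined by data with finitely
    many values and measurable fibers ([peak_memory_measurable]). *)

(** * Independent Bernoulli masks *)

Definition mask_weight {R : realType} {m n : nat} (delta : R)
    (S : 'M[bool]_(m, n)) : R :=
  \prod_i \prod_j (if S i j then delta else 1 - delta).

Lemma mask_weight_ge0 {R : realType} {m n : nat} {delta : R}
    (S : 'M[bool]_(m, n)) : 0 <= delta <= 1 -> 0 <= mask_weight delta S.
Proof.
move=> /andP[d0 d1]; apply: prodr_ge0 => i _; apply: prodr_ge0 => j _.
by case: ifP => // _; rewrite subr_ge0.
Qed.

(** The factors are identically distributed, so the law is exchangeable: this is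
    what makes the order of arrival irrelevant to every count below. *)
Lemma mask_weight_col_perm (R : realType) (m n : nat) (delta : R)
    (o : 'S_n) (S : 'M[bool]_(m, n)) :
  mask_weight delta (col_perm o S) = mask_weight delta S.
Proof.
apply: eq_bigr => i _; rewrite [RHS](reindex_inj (@perm_inj _ o)).
by apply: eq_bigr => j _; rewrite mxE.
Qed.

(** Independence of the entries of a mask: the mean of a product of functions of
    single entries factorizes. *)
Lemma mask_weight_mean {R : realType} {m n : nat} (delta : R)
    (h : 'I_m * 'I_n -> bool -> R) :
  \sum_(S : 'M[bool]_(m, n)) mask_weight delta S * \prod_p h p (S p.1 p.2) =
  \prod_p (delta * h p true + (1 - delta) * h p false).
Proof.
pose g p (b : bool) := (if b then delta else 1 - delta) * h p b.
transitivity (\prod_p \sum_(b : bool) g p b); last first.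
  by apply: eq_bigr => p _; rewrite big_bool.
rewrite bigA_distr_bigA.
rewrite (reindex (fun f : {ffun 'I_m * 'I_n -> bool} =>
  \matrix_(i, j) f (i, j))) /=; last first.
  exists (fun S : 'M[bool]_(m, n) => [ffun p => S p.1 p.2]) => [f|S] _.
    by apply/ffunP => -[i j]; rewrite ffunE mxE.
  by apply/matrixP => i j; rewrite mxE ffunE.
apply: eq_bigr => f _; rewrite /mask_weight pair_bigA -big_split /=.
by apply: eq_bigr => -[i j] _; rewrite /g !mxE.
Qed.

Lemma mask_weight_cov (R : realType) (m n : nat) (delta : R)
    (p q : 'I_m * 'I_n) :
  \sum_(S : 'M[bool]_(m, n)) mask_weight delta S *
    (((S p.1 p.2)%:R - delta) * ((S q.1 q.2)%:R - delta)) =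
  (delta * (1 - delta)) *+ (p == q).
Proof.
(* Indicator-weighted factors, so that a product over all cells is the centered
   entry at [a]. *)
pose c (a r : 'I_m * 'I_n) (b : bool) : R := if r == a then b%:R - delta else 1.
have cE a (S : 'M[bool]_(m, n)) :
    (S a.1 a.2)%:R - delta = \prod_r c a r (S r.1 r.2).
  rewrite (bigD1 a) //= {1}/c eqxx big1 ?mulr1 // => r /negPf ra.
  by rewrite /c ra.
transitivity (\prod_r (delta * (c p r true * c q r true) +
                       (1 - delta) * (c p r false * c q r false))).
  rewrite -(mask_weight_mean _ (fun r b => c p r b * c q r b)).
  by apply: eq_bigr => S _; rewrite !cE big_split.
rewrite (bigD1 p) //= /c eqxx; case: eqVneq => [<-|pq].
  rewrite big1 => [|r /negPf rp]; first by rewrite /= mulr1n; ring.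
  by rewrite rp; ring.
by rewrite /= !mulr0n; ring.
Qed.

Definition mask_count {m n : nat} (J : {set 'I_m * 'I_n})
    (S : 'M[bool]_(m, n)) : nat := \sum_(p in J) S p.1 p.2.

(** Distinct entries are uncorrelated ([mask_weight_cov]), so that only the
    diagonal terms of the expanded square remain. *)
Lemma mask_count_variance (R : realType) (m n : nat) (delta : R)
    (J : {set 'I_m * 'I_n}) :
  \sum_(S : 'M[bool]_(m, n)) mask_weight delta S *
    ((mask_count J S)%:R - delta * #|J|%:R) ^+ 2 =
  #|J|%:R * (delta * (1 - delta)).
Proof.
under eq_bigr => S _.
  have -> : (mask_count J S)%:R - delta * #|J|%:R =
            \sum_(p in J) ((S p.1 p.2)%:R - delta).
    by rewrite sumrB natr_sum sumr_const mulr_natr.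
  rewrite expr2 big_distrlr /= mulr_sumr.
  under eq_bigr => p _ do rewrite mulr_sumr.
  over.
rewrite exchange_big /=.
transitivity (\sum_(p in J) delta * (1 - delta)); last first.
  by rewrite sumr_const mulr_natl.
apply: eq_bigr => p pJ; rewrite exchange_big /=.
under eq_bigr => q _ do rewrite mask_weight_cov.
rewrite (bigD1 p) //= eqxx big1 ?addr0 // => q /andP[_ /negPf qp].
by rewrite eq_sym qp.
Qed.

(** Chebyshev's inequality and a union bound at once: on the event, the sum over
    [i] of the squared relative deviations is at least 1, and its mean is
    computed by [mask_count_variance]. *)
Lemma mask_count_chebyshev {R : realType} {m n : nat} {delta : R}
    {I : finType} (J : I -> {set 'I_m * 'I_n}) (a : I -> R) :
  0 <= delta <= 1 -> (forall i, 0 < a i) ->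
  \sum_(S : 'M[bool]_(m, n) |
        [exists i, delta * #|J i|%:R + a i < (mask_count (J i) S)%:R])
    mask_weight delta S <=
  \sum_i #|J i|%:R * delta / a i ^+ 2.
Proof.
move=> d01 a_gt0.
pose dev i (S : 'M[bool]_(m, n)) : R :=
  ((mask_count (J i) S)%:R - delta * #|J i|%:R) ^+ 2.
pose ratio S := \sum_i dev i S / a i ^+ 2.
have ratio_ge0 S i : 0 <= dev i S / a i ^+ 2 by rewrite divr_ge0 ?sqr_ge0.
apply: (@le_trans _ _ (\sum_S mask_weight delta S * ratio S)).
  rewrite big_mkcond; apply: ler_sum => S _.
  have w0 := mask_weight_ge0 S d01.
  case: ifP => [/existsP[i Ji]|_]; last by rewrite mulr_ge0 ?sumr_ge0.
  rewrite -[leLHS]mulr1 ler_wpM2l //.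
  suff dev_i : 1 <= dev i S / a i ^+ 2.
    by apply: (le_trans dev_i); rewrite /ratio (bigD1 i) //= lerDl sumr_ge0.
  rewrite ler_pdivlMr ?exprn_gt0 // mul1r /dev.
  have dev_gt : a i < (mask_count (J i) S)%:R - delta * #|J i|%:R.
    by rewrite ltrBrDl.
  by rewrite ler_sqr ?nnegrE ?(ltW dev_gt) ?(ltW (a_gt0 i)) //
    (le_trans (ltW (a_gt0 i)) (ltW dev_gt)).
under eq_bigr => S _ do rewrite mulr_sumr.
rewrite exchange_big /=; apply: ler_sum => i _.
under eq_bigr => S _ do rewrite mulrA.
rewrite -mulr_suml mask_count_variance ler_wpM2r ?invr_ge0 ?sqr_ge0 //.
rewrite ler_wpM2l //; case/andP: d01 => d0 d1; nra.
Qed.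

(** * The observation mask in order of arrival *)

(** Permuting the columns of the observation mask by the order of arrival yields
    a mask with the same law; the noise is integrated out by taking all of
    its events to be full. *)
Lemma arrival_mask_law {d} {T : measurableType d} {R : realType}
    {P : probability T R} {m n : nat} {delta : R}
    {X : 'I_m -> 'I_n -> {RV P >-> R}} {S : T -> 'M[bool]_(m, n)}
    {order : T -> 'S_n} (bad : pred 'M[bool]_(m, n)) :
  sampling_law delta X S order ->
  measurable [set w | bad (col_perm (order w) (S w))] /\
  P [set w | bad (col_perm (order w) (S w))] =
  (\sum_(S0 | bad S0) mask_weight delta S0)%:E.
Proof.
move=> [mS mo law].
pose F (q : 'M[bool]_(m, n) * 'S_n) := [set w | S w = q.1 /\ order w = q.2].
have mF q : measurable (F q) by apply: measurableI; [apply: mS|apply: mo].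
pose D := [set` [pred q : 'M[bool]_(m, n) * 'S_n | bad (col_perm q.2 q.1)]].
have FE : [set w | bad (col_perm (order w) (S w))] = \bigcup_(q in D) F q.
  apply/seteqP; split => [w bw|w [[S0 o] /= bq [/= -> ->]]//].
  by exists (S w, order w).
have finD : finite_set D by exact: finite_finset.
split; first by rewrite FE; exact: fin_bigcup_measurable.
have PF q : P (F q) = (mask_weight delta q.1 * (n`!%:R)^-1)%:E.
  have := law (fun _ _ => setT) q.1 q.2 (fun _ _ => measurableT).
  have -> : data_event X S order (fun _ _ => setT) q.1 q.2 = F q.
    by apply/seteqP; split => w [] // *; split.
  move=> ->; rewrite EFinM big1 ?mul1e // => i _; rewrite big1 // => j _.
  by rewrite preimage_setT probability_setT.
rewrite FE measure_fin_bigcup //; last first.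
  by move=> [a b] [a' b'] _ _ [w [[/= <- <-] [/= <- <-]]].
have -> : D = [set` enum [pred q : 'M[bool]_(m, n) * 'S_n |
                            bad (col_perm q.2 q.1)]].
  by apply/seteqP; split => q; rewrite /D /= mem_enum.
rewrite -fsbig_seq ?enum_uniq // big_enum_cond /=.
under eq_bigr => q _ do rewrite PF.
rewrite sumEFin; congr (_%:E); rewrite big_mkcond /=.
pose G (a : 'M[bool]_(m, n)) (o : 'S_n) :=
  if bad (col_perm o a) then mask_weight delta a * (n`!%:R)^-1 else 0.
transitivity (\sum_a \sum_o G a o).
  by rewrite pair_bigA; apply: eq_bigr => q _; rewrite andbT.
rewrite exchange_big /= [RHS]big_mkcond /=.
transitivity (\sum_(o : 'S_n)
    (\sum_a if bad a then mask_weight delta a else 0) * (n`!%:R)^-1 : R).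
  apply: eq_bigr => o _; rewrite mulr_suml.
  have colK (p : 'S_n) : cancel (@col_perm bool m n p) (col_perm (p^-1)%g).
    by move=> a; rewrite -col_permM mulVg col_perm1.
  rewrite [RHS](reindex_inj (can_inj (colK o))) /=.
  apply: eq_bigr => a _; rewrite /G mask_weight_col_perm.
  by case: ifP => _ //; rewrite mul0r.
rewrite sumr_const card_Sn -[LHS]mulr_natr -mulrA mulVf ?mulr1 //.
Qed.

(** * Non-zero entries of the stored matrices *)

Lemma nnz_le (R : realType) (p q : nat) (A B : 'M[R]_(p, q)) :
  (forall i j, A i j != 0 -> B i j != 0) -> (nnz A <= nnz B)%N.
Proof.
move=> AB; apply: leq_sum => i _; apply: subset_leq_card.
by apply/fintype.subsetP => j; rewrite !inE; exact: AB.
Qed.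

Lemma nnz_erase_rows (R : realType) (p q : nat) (c : R) (A : 'M[R]_(p, q)) :
  (nnz (erase_rows c A) <= nnz A)%N.
Proof. by apply: nnz_le => i j; rewrite mxE; case: ifP => // _; rewrite eqxx. Qed.

Lemma nnz_split_part (R : realType) (p q : nat) (g : 'M[{set 'I_4}]_(p, q))
  (i : nat) (A : 'M[R]_(p, q)) : (nnz (split_part g i A) <= nnz A)%N.
Proof. by apply: nnz_le => u v; rewrite mxE; case: ifP => // _; rewrite eqxx. Qed.

Lemma nnz_erase_cols (R : realType) (p q : nat) (c : R) (A : 'M[R]_(p, q)) :
  (nnz (erase_cols c A) <= nnz A)%N.
Proof.
by apply: nnz_le => i j; rewrite !mxE; case: ifP => // _; rewrite eqxx.
Qed.

Lemma row_nnzE (R : realType) (p q : nat) (A : 'M[R]_(p, q)) (i : 'I_p) :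
  row_nnz A i = (\sum_j (A i j != 0%R))%N.
Proof.
rewrite /row_nnz -sum1_card big_mkcond; apply: eq_bigr => j _.
by rewrite inE; case: (A i j != 0).
Qed.

Definition columns (m : nat) {n : nat} (B : {set 'I_n}) : {set 'I_m * 'I_n} :=
  finset.setX (finset.setTfor 'I_m) B.

Lemma card_columns (m n : nat) (B : {set 'I_n}) : #|columns m B| = (m * #|B|)%N.
Proof. by rewrite /columns cardsX cardsT card_ord. Qed.

Lemma mask_count_columns (m n : nat) (B : {set 'I_n}) (S : 'M[bool]_(m, n)) :
  mask_count (columns m B) S = (\sum_i \sum_(j in B) S i j)%N.
Proof.
rewrite /mask_count (pair_big_dep xpredT (fun _ j => j \in B)
  (fun i j => nat_of_bool (S i j))).
by apply: eq_bigl => -[i j]; rewrite inE /= inE.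
Qed.

Definition batch_columns (n l : nat) : {set 'I_n} :=
  [set j : 'I_n | (j < l)%N]%SET.

Lemma card_batch_columns (n l : nat) : (#|batch_columns n l| <= l)%N.
Proof.
rewrite cardE -(size_map val) -[leqRHS](size_iota 0).
apply: uniq_leq_size; first by rewrite map_inj_uniq ?enum_uniq //; exact: val_inj.
by move=> j /mapP[i]; rewrite mem_enum inE => il ->; rewrite mem_iota.
Qed.

(** [first_cols] pads with zeros when [l > n]; both sums are therefore compared
    over the common range [maxn l n]. *)
Lemma nnz_first_cols {R : realType} {m n : nat} (l : nat) {A : 'M[R]_(m, n)}
    {S : 'M[bool]_(m, n)} :
  (forall i j, A i j != 0 -> S i j) ->
  (nnz (first_cols l A) <= mask_count (columns m (batch_columns n l)) S)%N.
Proof.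
move=> AS; rewrite mask_count_columns; apply: leq_sum => i _; rewrite row_nnzE.
pose g (j : nat) : nat := if insub j is Some j' then A i j' != 0 else false.
have -> : (\sum_(j < l) (first_cols l A i j != 0%R))%N = (\sum_(j < l) g j)%N.
  apply: eq_bigr => j _; rewrite !mxE /g.
  by case: (insub (j : nat)) => [j'|]; rewrite ?mxE ?eqxx.
rewrite (big_ord_widen (maxn l n)) ?leq_maxl //.
apply: (@leq_trans (\sum_(j < n | (j < l)%N) g j)).
  rewrite (@big_ord_widen_cond _ _ _ n (maxn l n) (fun j => (j < l)%N) g)
    ?leq_maxr // [leqLHS]big_mkcond [leqRHS]big_mkcond.
  apply: leq_sum => j _ /=.
  case: (ltnP j n) => [_|nj]; first by rewrite andbT.
  by rewrite /g insubF ?if_same // ltnNge nj.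
rewrite [leqRHS](eq_bigl (fun j : 'I_n => (j < l)%N)) => [|j]; last by rewrite inE.
apply: leq_sum => j _; rewrite /g insubT => // lt_jn.
have -> : Sub (nat_of_ord j) lt_jn = j by exact: val_inj.
by have := AS i j; case: eqP => //= _ ->.
Qed.

Lemma nnz_col {R : realType} {m n : nat} {A : 'M[R]_(m, n)}
    {S : 'M[bool]_(m, n)} (t : 'I_n) :
  (forall i j, A i j != 0 -> S i j) ->
  (nnz (col t A) <= mask_count (columns m [set t]%SET) S)%N.
Proof.
move=> AS; rewrite mask_count_columns; apply: leq_sum => i _.
rewrite row_nnzE big_ord1 big_set1 mxE.
by have := AS i t; case: eqP => //= _ ->.
Qed.

(** * Peak memory of a run *)

(** Counting the objects in memory and bounding the largest one loses a constant
    factor only. *)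
Lemma peak_memory_le (R : realType) (cval cid b : R) (m N : nat)
    (t : trace R) : 0 <= b ->
  all (fun st => (size st <= N)%N &&
                 all (fun o => stored_size cval cid m o <= b) st) t ->
  peak_memory cval cid m t <= N%:R * b.
Proof.
move=> b0; rewrite /peak_memory.
elim: t => [_|st t IH /= /andP[/andP[size_st st_le] /IH t_le]].
  by rewrite big_nil mulr_ge0.
rewrite big_cons ge_max t_le andbT.
apply: (@le_trans _ _ ((size st)%:R * b)); last by rewrite ler_wpM2r // ler_nat.
elim: st st_le {size_st} => [_|o st IHst /= /andP[le_o /IHst st_le]].
  by rewrite big_nil mul0r.
by rewrite big_cons -natr1 mulrDl mul1r addrC lerD.
Qed.

Lemma all_flatten_map (A B : Type) (p : pred B) (f : A -> seq B) (s : seq A) :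
  (forall a, all p (f a)) -> all p (flatten [seq f a | a <- s]).
Proof. by move=> pf; elim: s => //= a s IH; rewrite all_cat pf. Qed.

(** The number 12 is attained when the accumulator has been created and the batch
    not yet discarded.  Every sparse object that is ever stored is a sub-pattern
    of the batch or of one column of the stream, so only these two counts matter
    besides the dense dimensions. *)
Lemma smc_peak_memory_le (R : realType) (cval cid b : R)
    (sub : subroutines R) (m n l k : nat) (x : smc_input R m n l k) :
  0 <= b -> 0 <= cval + cid * ln (m%:R : R) ->
  (nnz (smc_batch x))%:R * (cval + cid * ln m%:R) <= b ->
  (forall t, (nnz (col t (stream x)))%:R * (cval + cid * ln m%:R) <= b) ->
  cval <= b -> l%:R * cval <= b ->
  (m * k)%:R * cval <= b -> (n * k)%:R * cval <= b ->
  (l * k)%:R * cval <= b -> (k * k)%:R * cval <= b -> 0 <= cval ->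
  peak_memory cval cid m (smc_trace sub x) <= 12%:R * b.
Proof.
move=> b0 e0 batch_le col_le c_le l_le mk_le nk_le lk_le kk_le c0.
have sparse_le p q (A : 'M[R]_(p, q)) p' q' (B : 'M[R]_(p', q')) :
    (nnz A <= nnz B)%N -> (nnz B)%:R * (cval + cid * ln m%:R) <= b ->
    (nnz A)%:R * (cval + cid * ln m%:R) <= b.
  by move=> AB; apply: le_trans; rewrite ler_wpM2r // ler_nat.
have B_le i : (nnz (smc_B x i))%:R * (cval + cid * ln m%:R) <= b.
  by apply: sparse_le batch_le; exact: nnz_split_part.
have A_le i t : (nnz (smc_A x i t))%:R * (cval + cid * ln m%:R) <= b.
  by apply: sparse_le (col_le t); exact: nnz_split_part.
have Bt_le : (nnz (spca_trim (smc_B x 1)))%:R * (cval + cid * ln m%:R) <= b.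
  by apply: sparse_le (B_le 1%N); exact: nnz_erase_rows.
have B2r_le : (nnz (smc_B2_rows x))%:R * (cval + cid * ln m%:R) <= b.
  by apply: sparse_le (B_le 2%N); exact: nnz_erase_rows.
have B2c_le : (nnz (smc_B2_cols x))%:R * (cval + cid * ln m%:R) <= b.
  by apply: sparse_le B2r_le; exact: nnz_erase_cols.
have tk_le t : (t <= n)%N -> (t * k)%:R * cval <= b.
  move=> tn; apply: le_trans nk_le; rewrite ler_wpM2r // ler_nat.
  by rewrite leq_mul2r tn orbT.
have d_le : (1 * 1)%:R * cval <= b by rewrite mul1r.
have D_le : (1 * l)%:R * cval <= b by rewrite mul1n.
apply: peak_memory_le => //; rewrite /smc_trace /spca_trace.
rewrite !all_cat.
have le := (batch_le, col_le, B_le, A_le, Bt_le, B2r_le, B2c_le,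
  d_le, D_le, mk_le, nk_le, lk_le, kk_le).
apply/and5P; split.
- by rewrite /= !le.
- rewrite map_cat all_cat; apply/andP; split; first by rewrite /= !le.
  by rewrite all_map; apply: all_flatten_map => tau; rewrite /= !le.
- by rewrite /= !le.
- by apply: all_flatten_map => t; rewrite /= !le !tk_le // ltnW.
- by rewrite /= !le.
Qed.

(** * Overloaded masks *)

(** [None] stands for the batch and [Some t] for the column that arrives at
    time [t]. *)
Definition cell_family (m n l : nat) (i : option 'I_n) : {set 'I_m * 'I_n} :=
  if i is Some t then columns m [set t]%SET else columns m (batch_columns n l).

(** Allowed excess over the mean, in number of entries: multiplied by the cost
    [O(log m)] of an entry it gives [O(k * m)] for the batch and [O(m + n)] for
    a column. *)
Definition slack {R : realType} (m n k : nat) (i : option 'I_n) : R :=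
  (if i is Some _ then (m + n)%:R else (k * m)%:R) / ln m%:R.

Definition overloaded {R : realType} (delta : R) (k l : nat) {m n : nat}
    (S : 'M[bool]_(m, n)) : bool :=
  [exists i, delta * #|cell_family m n l i|%:R + slack m n k i <
             (mask_count (cell_family m n l i) S)%:R].

(** The batch has variance at most [2 * k * m / L]; divided by the square of its
    slack [k * m / L] this is at most [2 * L / (k * m) <= 2 * delta * L ^+ 2],
    because [delta * m >= k * L ^+ 2].  For the columns, allowing [m + n] instead
    of [m] in the slack makes the variance bound survive the union over the [n]
    columns:
    [n * (m * delta * L ^+ 2 / (m + n) ^+ 2) <= delta * L ^+ 2], whatever the
    ratio of [n] to [m]. *)
Lemma overload_probability (R : realType) (m n k l : nat) (delta : R) :
  let L := ln m%:R in
  (0 < k)%N -> (0 < m)%N -> 0 <= delta <= 1 -> 1 <= L ->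
  k%:R * L ^+ 2 <= delta * m%:R -> l%:R * delta * L <= 2 * k%:R ->
  \sum_(S : 'M[bool]_(m, n) | overloaded delta k l S) mask_weight delta S <=
  3 * (delta * L ^+ 2).
Proof.
move=> L k0 m0 d01 L1 kL lL.
have L0 : 0 < L by exact: lt_le_trans L1.
have kR : 1 <= k%:R :> R by rewrite ler1n.
have mR : 1 <= m%:R :> R by rewrite ler1n.
have nR : 0 <= n%:R :> R by [].
have d0 : 0 <= delta by case/andP: d01.
apply: le_trans (mask_count_chebyshev _ _ d01 _) _.
  move=> [t|]; rewrite /slack divr_gt0 // ltr0n ?muln_gt0 ?k0 ?m0 //.
  by rewrite addn_gt0 m0.
have dL0 : 0 <= delta * L ^+ 2 by rewrite mulr_ge0 ?sqr_ge0.
rewrite (bigD1 None) //=.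
have -> : 3 * (delta * L ^+ 2) = 2 * (delta * L ^+ 2) + delta * L ^+ 2 by ring.
apply: lerD.
  have km0 : 0 < (k * m)%:R :> R by rewrite ltr0n muln_gt0 k0.
  rewrite /slack ler_pdivrMr ?exprn_gt0 ?divr_gt0 // card_columns -/L.
  have -> : 2 * (delta * L ^+ 2) * ((k * m)%:R / L) ^+ 2 =
            2 * delta * (k%:R * m%:R) ^+ 2.
    by rewrite natrM; field; rewrite gt_eqF.
  have bl : (#|batch_columns n l|)%:R <= l%:R :> R.
    by rewrite ler_nat card_batch_columns.
  apply: (@le_trans _ _ (m%:R * (l%:R * delta * L))).
    rewrite natrM -!mulrA ler_wpM2l // ler_pM // ?mulr_ge0 //.
    by rewrite -[leLHS]mulr1 ler_wpM2l.
  apply: (@le_trans _ _ (m%:R * (2 * k%:R))); first by rewrite ler_wpM2l.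
  have -> : 2 * delta * (k%:R * m%:R) ^+ 2 =
            m%:R * (2 * k%:R * (k%:R * (delta * m%:R))) by ring.
  rewrite ler_wpM2l // -[leLHS]mulr1 ler_wpM2l ?mulr_ge0 //.
  by rewrite mulr_ege1 // (le_trans _ kL) // mulr_ege1 // exprn_ege1.
(* Each column gets an equal share of [delta * L ^+ 2]. *)
apply: (@le_trans _ _ (\sum_(i : option 'I_n | i != None) delta * L ^+ 2 / n%:R)).
  apply: ler_sum => -[t _|//].
  have n0 : 0 < n%:R :> R by rewrite ltr0n (leq_ltn_trans _ (ltn_ord t)).
  have mn0 : 0 < (m + n)%:R :> R by rewrite natrD ltr_pwDl // (lt_le_trans _ mR).
  rewrite card_columns cards1 muln1 /slack.
  rewrite ler_pdivrMr ?exprn_gt0 ?divr_gt0 // -/L.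
  have -> : delta * L ^+ 2 / n%:R * ((m + n)%:R / L) ^+ 2 =
            delta * ((m%:R + n%:R) ^+ 2 / n%:R).
    by rewrite natrD; field; rewrite !gt_eqF.
  rewrite mulrC ler_wpM2l // ler_pdivlMr //; nra.
rewrite sumr_const cardC1 card_option card_ord /= -[leLHS]mulr_natr.
have [->|n0] := posnP n; first by rewrite mulr0.
by rewrite mulfVK // pnatr_eq0 -lt0n.
Qed.

Lemma dimension_bounds {m n k l : nat} (U := (k * m + k * n)%N) :
  (0 < k)%N -> (k <= m)%N -> (k <= n)%N -> (l <= 2 * n)%N ->
  [/\ [/\ (1 <= 2 * U)%N, (l <= 2 * U)%N & (m * k <= 2 * U)%N],
      [/\ (n * k <= 2 * U)%N, (l * k <= 2 * U)%N & (k * k <= 2 * U)%N] &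
      (m + (m + n) <= 3 * U)%N].
Proof. by rewrite /U => k0 km kn ln2; split; [split|split|]; nia. Qed.

(** Every object of the trace fits in [3 * (cval + cid) * (k * m + k * n)], and at
    most 12 are present at a time.  The factor [delta * m * L <= m] for a column
    is where sparsity of the sampling enters. *)
Lemma smc_memory_not_overloaded {R : realType} {cval cid : R}
    {sub : subroutines R} {m n k l : nat} {x : smc_input R m n l k} {delta : R}
    (S : 'M[bool]_(m, n)) :
  let L := ln m%:R in
  0 < cval -> 0 < cid -> (0 < k)%N -> (k <= m)%N -> (k <= n)%N ->
  0 <= delta -> 1 <= L -> delta * L ^+ 2 <= 1 ->
  l%:R * delta * L <= 2 * k%:R -> (l <= 2 * n)%N ->
  (forall i j, stream x i j != 0 -> S i j) -> ~~ overloaded delta k l S ->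
  peak_memory cval cid m (smc_trace sub x) <=
  36 * (cval + cid) * (k * m + k * n)%:R.
Proof.
move=> L cval0 cid0 k0 km kn d0 L1 dL lL ln2 xS /existsPn fits.
have [[U1 lU mkU] [nkU lkU kkU] column_U] := dimension_bounds k0 km kn ln2.
have L0 : 0 < L by exact: lt_le_trans L1.
have dL1 : delta * L <= 1.
  by apply: le_trans dL; rewrite ler_wpM2l // -[leLHS]mulr1 expr2 ler_pM2l.
have c0 : 0 < cval + cid by rewrite addr_gt0.
have unit_le : cval + cid * L <= (cval + cid) * L.
  by rewrite mulrDl lerD2r -[leLHS]mulr1 ler_pM2l.
have mR : 0 <= m%:R :> R by [].
have sparse_le p q (A : 'M[R]_(p, q)) i :
    (nnz A <= mask_count (cell_family m n l i) S)%N ->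
    (nnz A)%:R * (cval + cid * L) <=
    (delta * #|cell_family m n l i|%:R + slack m n k i) * ((cval + cid) * L).
  move=> AJ; apply: ler_pM => //; first by rewrite addr_ge0 ?mulr_ge0 ?ltW.
  apply: (@le_trans _ _ (mask_count (cell_family m n l i) S)%:R).
    by rewrite ler_nat.
  by rewrite leNgt fits.
pose b : R := 3 * ((cval + cid) * (k * m + k * n)%:R).
have dense_le N : (N <= 2 * (k * m + k * n))%N -> N%:R * cval <= b.
  move=> NU; rewrite /b.
  have : N%:R <= 2 * (k * m + k * n)%:R :> R by rewrite -natrM ler_nat.
  have : 0 <= (k * m + k * n)%:R :> R by [].
  move: (_%:R) => U; move: (N%:R) => r; nra.
have -> : 36 * (cval + cid) * (k * m + k * n)%:R = 12 * b by rewrite /b; ring.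
apply: smc_peak_memory_le.
- by rewrite /b mulr_ge0 // mulr_ge0 // ltW.
- by rewrite addr_ge0 ?mulr_ge0 ?ltW.
- apply: le_trans (sparse_le _ _ _ None (nnz_first_cols l xS)) _.
  rewrite /slack card_columns.
  have bl : (#|batch_columns n l|)%:R <= l%:R :> R.
    by rewrite ler_nat card_batch_columns.
  have -> : (delta * (m * #|batch_columns n l|)%:R + (k * m)%:R / ln m%:R) *
            ((cval + cid) * L) =
            (cval + cid) *
            (m%:R * (#|batch_columns n l|%:R * delta * L) + (k * m)%:R).
    by rewrite !natrM -/L; field; rewrite gt_eqF.
  rewrite /b [leRHS]mulrCA ler_pM2l //.
  apply: (@le_trans _ _ (m%:R * (2 * k%:R) + (k * m)%:R)).
    rewrite lerD2r ler_wpM2l // (le_trans _ lL) // -!mulrA ler_wpM2r //.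
    by rewrite mulr_ge0 // ltW.
  have -> : m%:R * (2 * k%:R) + (k * m)%:R = (3 * (k * m))%:R :> R.
    by rewrite !natrM; ring.
  by rewrite -natrM ler_nat leq_mul2l leq_addr.
- move=> t; apply: le_trans (sparse_le _ _ _ (Some t) (nnz_col t xS)) _.
  rewrite /slack card_columns cards1 muln1.
  have -> : (delta * m%:R + (m + n)%:R / ln m%:R) * ((cval + cid) * L) =
            (cval + cid) * (m%:R * (delta * L) + (m + n)%:R).
    by rewrite -/L; field; rewrite gt_eqF.
  rewrite /b [leRHS]mulrCA ler_pM2l //.
  apply: (@le_trans _ _ (m + (m + n))%:R).
    by rewrite [leRHS]natrD lerD2r -[leRHS]mulr1 ler_wpM2l.
  by rewrite -natrM ler_nat column_U.
- by rewrite -[leLHS]mul1r; exact: (dense_le 1%N).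
- exact: dense_le.
- exact: dense_le.
- exact: dense_le.
- exact: dense_le.
- exact: dense_le.
- exact: ltW.
Qed.

(** * Dependence of the memory on the signs of the data *)

(** The sizes of sparse matrices, and the thresholds of the erasing steps, see
    the values only through the zero and the positive entries. *)
Definition same_sign {R : realType} {p q : nat} (A B : 'M[R]_(p, q)) : Prop :=
  forall i j, Num.sg (A i j) = Num.sg (B i j).

Lemma row_nnz_same_sign {R : realType} {p q : nat} {A B : 'M[R]_(p, q)}
    (i : 'I_p) :
  same_sign A B -> row_nnz A i = row_nnz B i.
Proof.
by move=> AB; apply: eq_card => j; rewrite !inE -sgr_eq0 AB sgr_eq0.
Qed.

Lemma nnz_same_sign {R : realType} {p q : nat} {A B : 'M[R]_(p, q)} :
  same_sign A B -> nnz A = nnz B.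
Proof. by move=> AB; apply: eq_bigr => i _; exact: row_nnz_same_sign. Qed.

Lemma density_same_sign {R : realType} {p q : nat} {A B : 'M[R]_(p, q)} :
  same_sign A B -> density A = density B.
Proof.
move=> AB; congr (_%:R / _); apply: eq_card => u.
by rewrite !inE -sgr_gt0 AB sgr_gt0.
Qed.

Lemma trmx_same_sign {R : realType} {p q : nat} {A B : 'M[R]_(p, q)} :
  same_sign A B -> same_sign A^T B^T.
Proof. by move=> AB i j; rewrite !mxE. Qed.

Lemma col_same_sign {R : realType} {p q : nat} {A B : 'M[R]_(p, q)} (t : 'I_q) :
  same_sign A B -> same_sign (col t A) (col t B).
Proof. by move=> AB i j; rewrite !mxE. Qed.

Lemma erase_rows_same_sign {R : realType} {p q : nat} (c : R)
    {A B : 'M[R]_(p, q)} :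
  same_sign A B -> same_sign (erase_rows c A) (erase_rows c B).
Proof.
by move=> AB i j; rewrite !mxE (row_nnz_same_sign _ AB); case: ifP.
Qed.

Lemma erase_cols_same_sign {R : realType} {p q : nat} (c : R)
    {A B : 'M[R]_(p, q)} :
  same_sign A B -> same_sign (erase_cols c A) (erase_cols c B).
Proof.
by move=> AB; apply/trmx_same_sign/erase_rows_same_sign/trmx_same_sign.
Qed.

Lemma first_cols_same_sign {R : realType} {p q : nat} (a : nat)
    {A B : 'M[R]_(p, q)} :
  same_sign A B -> same_sign (first_cols a A) (first_cols a B).
Proof.
by move=> AB i j; rewrite !mxE; case: insub => [j'|]; rewrite ?mxE.
Qed.

Lemma split_part_same_sign {R : realType} {p q : nat} (g : 'M[{set 'I_4}]_(p, q))
    (i : nat) {A B : 'M[R]_(p, q)} :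
  same_sign A B -> same_sign (split_part g i A) (split_part g i B).
Proof. by move=> AB u v; rewrite !mxE; case: ifP. Qed.

Lemma spca_trim_same_sign {R : realType} {p q : nat} {A B : 'M[R]_(p, q)} :
  same_sign A B -> same_sign (spca_trim A) (spca_trim B).
Proof.
move=> AB; rewrite /spca_trim (density_same_sign AB).
exact: erase_rows_same_sign.
Qed.

(** The traces of two runs have the same shape; this lemma and the next two
    compare them block by block. *)
Lemma eq_map_cat (A B : Type) (f : A -> B) (a a' b b' : seq A) :
  map f a = map f a' -> map f b = map f b' -> map f (a ++ b) = map f (a' ++ b').
Proof. by rewrite !map_cat => -> ->. Qed.

Lemma eq_map_flatten (I A B : Type) (f : A -> B) (g g' : I -> seq A) (s : seq I) :
  (forall i, map f (g i) = map f (g' i)) ->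
  map f (flatten (map g s)) = map f (flatten (map g' s)).
Proof. by move=> gg'; elim: s => //= i s IH; rewrite !map_cat gg' IH. Qed.

Lemma eq_map_prefix (A B : Type) (f : A -> B) (a a' : seq A) (t t' : seq (seq A)) :
  map f a = map f a' -> map (map f) t = map (map f) t' ->
  map (map f) [seq a ++ st | st <- t] = map (map f) [seq a' ++ st | st <- t'].
Proof.
move=> aa' tt'.
have catE b u : map (map f) [seq b ++ st | st <- u] =
                map (cat (map f b)) (map (map f) u).
  by rewrite -!map_comp; apply: eq_map => st /=; rewrite map_cat.
by rewrite !catE aa' tt'.
Qed.

Lemma eq_peak_memory (R : realType) (cval cid : R) (m : nat) (t t' : trace R) :
  let sizes := map (map (stored_size cval cid m)) in
  sizes t = sizes t' -> peak_memory cval cid m t = peak_memory cval cid m t'.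
Proof.
have peakE s : peak_memory cval cid m s =
    \big[Num.max/0]_(r <- map (map (stored_size cval cid m)) s) \sum_(v <- r) v.
  by rewrite big_map; apply: eq_bigr => st _; rewrite big_map.
by move=> /= tt'; rewrite (peakE t) (peakE t') tt'.
Qed.

Lemma peak_memory_same_sign (R : realType) (cval cid : R) (sub : subroutines R)
    (m n l k : nat) (x y : smc_input R m n l k) :
  same_sign (stream x) (stream y) ->
  gbatch x = gbatch y -> gstream x = gstream y ->
  peak_memory cval cid m (smc_trace sub x) =
  peak_memory cval cid m (smc_trace sub y).
Proof.
move=> xy gb gs.
have batchE : same_sign (smc_batch x) (smc_batch y).
  exact: first_cols_same_sign.
have BE i : same_sign (smc_B x i) (smc_B y i).
  by rewrite /smc_B gb; exact: split_part_same_sign.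
have AE i t : nnz (smc_A x i t) = nnz (smc_A y i t).
  rewrite /smc_A gs; apply/nnz_same_sign/split_part_same_sign.
  exact: col_same_sign.
have colE t : nnz (col t (stream x)) = nnz (col t (stream y)).
  exact/nnz_same_sign/col_same_sign.
have BtE : nnz (spca_trim (smc_B x 1)) = nnz (spca_trim (smc_B y 1)).
  exact/nnz_same_sign/spca_trim_same_sign.
have B2r : same_sign (smc_B2_rows x) (smc_B2_rows y).
  exact: erase_rows_same_sign.
have B2c : nnz (smc_B2_cols x) = nnz (smc_B2_cols y).
  rewrite /smc_B2_cols /smc_density (density_same_sign batchE).
  exact/nnz_same_sign/erase_cols_same_sign.
have nnzE := (nnz_same_sign batchE, fun i => nnz_same_sign (BE i), AE, colE,
  BtE, nnz_same_sign B2r, B2c).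
apply: eq_peak_memory; apply: eq_map_cat; first by rewrite /= !nnzE.
apply: eq_map_cat.
  apply: eq_map_prefix; first by rewrite /= !nnzE.
  apply: eq_map_cat; first by rewrite /= !nnzE.
  by apply: eq_map_flatten => tau; rewrite /= !nnzE.
apply: eq_map_cat; first by rewrite /= !nnzE.
apply: eq_map_cat; last by rewrite /=.
by apply: eq_map_flatten => t; rewrite /= !nnzE.
Qed.

(** * Measurability of the memory event *)

(** A set that is a union of fibers of a map with finitely many values is a
    finite union of them; [f] collects the discrete data that determine the
    peak memory. *)
Lemma finite_measurable {d} {T : measurableType d} {F : finType} (f : T -> F)
    (A : set T) :
  (forall c, measurable (f @^-1` [set c])) ->
  (forall w w', f w = f w' -> A w -> A w') -> measurable A.
Proof.
move=> mf fA.
have -> : A = \bigcup_(c in f @` A) f @^-1` [set c].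
  apply/seteqP; split => [w Aw|w [_ [w' Aw' <-] /= /esym fw]]; last exact: fA Aw'.
  by exists (f w) => //; exists w.
by apply: fin_bigcup_measurable => // ; exact: finite_finset.
Qed.

Lemma mx_measurable d (T : measurableType d) (F : finType) (p q : nat)
    (f : T -> 'M[F]_(p, q)) :
  (forall i j c, measurable [set w | f w i j = c]) ->
  forall c, measurable (f @^-1` [set c]).
Proof.
move=> mf c.
have -> : f @^-1` [set c] =
    \bigcap_(i in [set: 'I_p]) \bigcap_(j in [set: 'I_q]) [set w | f w i j = c i j].
  apply/seteqP; split => [w /= <- //|w fw]; apply/matrixP => i j.
  exact: fw.
apply: fin_bigcap_measurable => [|i _]; first exact: finite_finset.
by apply: fin_bigcap_measurable => [|j _]; first exact: finite_finset.
Qed.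

Lemma pair_measurable d (T : measurableType d) (F G : Type) (f : T -> F)
    (g : T -> G) :
  (forall c, measurable (f @^-1` [set c])) ->
  (forall c, measurable (g @^-1` [set c])) ->
  forall c, measurable ((fun w => (f w, g w)) @^-1` [set c]).
Proof.
move=> mf mg [a b].
have -> : (fun w => (f w, g w)) @^-1` [set (a, b)] =
          f @^-1` [set a] `&` g @^-1` [set b].
  by apply/seteqP; split => w /= [-> ->].
exact: measurableI.
Qed.

Lemma sign_pattern_measurable d (T : measurableType d) (R : realType)
    (P : probability T R) (m n : nat) (M : 'M[R]_(m, n))
    (X : 'I_m -> 'I_n -> {RV P >-> R}) (c : 'M[bool * bool]_(m, n)) :
  measurable ((fun w => \matrix_(i, j)
    (0 < M i j + X i j w, M i j + X i j w < 0)) @^-1` [set c]).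
Proof.
apply: mx_measurable => i j {}c.
have mY : measurable_fun [set: T] (fun w => M i j + X i j w).
  by apply: measurable_funD => //; exact: measurable_funPT.
rewrite (_ : [set w | _] =
    (fun w => (0 < M i j + X i j w, M i j + X i j w < 0)) @^-1` [set c]).
  apply: pair_measurable => b; rewrite -[X in measurable X]setTI.
    by apply: measurable_fun_ltr.
  by apply: measurable_fun_ltr.
by apply/seteqP; split => w /=; rewrite mxE.
Qed.

Lemma eq_sgr (R : realDomainType) (y z : R) :
  (0 < y) = (0 < z) -> (y < 0) = (z < 0) -> Num.sg y = Num.sg z.
Proof. by move=> pos neg; rewrite !sgr_def !neq_lt pos neg. Qed.

(** The initial matrix [Q] of SPCA and the magnitudes of the data affect dense
    objects only, whose sizes are fixed by their dimensions. *)
Lemma peak_memory_measurable d (T : measurableType d) (R : realType)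
    (P : probability T R) (cval cid c : R) (sub : subroutines R)
    (m n k l : nat) (M : 'M[R]_(m, n)) (X : 'I_m -> 'I_n -> {RV P >-> R})
    (S : T -> 'M[bool]_(m, n)) (order : T -> 'S_n)
    (GB : T -> 'M[{set 'I_4}]_(m, l)) (GS : T -> 'M[{set 'I_4}]_(m, n))
    (Q : T -> 'M[R]_(l, k)) :
  (forall a, measurable (S @^-1` [set a])) ->
  (forall a, measurable (order @^-1` [set a])) ->
  (forall a, measurable (GB @^-1` [set a])) ->
  (forall a, measurable (GS @^-1` [set a])) ->
  measurable [set w | peak_memory cval cid m (smc_trace sub
    (SMCInput (observed_stream M (rv_mx X w) (S w) (order w))
       (GB w) (GS w) (Q w))) <= c].
Proof.
move=> mS mo mGB mGS.
pose sgn w : 'M[bool * bool]_(m, n) :=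
  \matrix_(i, j) (0 < M i j + X i j w, M i j + X i j w < 0).
apply: (finite_measurable (fun w => (sgn w, S w, order w, GB w, GS w))).
  do 4!apply: pair_measurable => //.
  exact: sign_pattern_measurable.
move=> w w' [sgnE SE oE GBE GSE] /=.
have le_eq (a b : R) : a = b -> a <= c -> b <= c by move=> ->.
apply: le_eq; apply: peak_memory_same_sign => // i j /=.
rewrite !mxE SE oE; case: ifP => // _.
move/matrixP: sgnE => /(_ i (order w' j)); rewrite !mxE => -[].
exact: eq_sgr.
Qed.

(** * Probability of the memory bound *)

Lemma smc_memory_probability {d} {T : measurableType d} {R : realType}
    {P : probability T R} {cval cid : R} (sub : subroutines R)
    {m n k l : nat} {delta : R} (M : 'M[R]_(m, n))
    (X : 'I_m -> 'I_n -> {RV P >-> R})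
    (S : T -> 'M[bool]_(m, n)) (order : T -> 'S_n)
    (GB : T -> 'M[{set 'I_4}]_(m, l)) (GS : T -> 'M[{set 'I_4}]_(m, n))
    (Q : T -> 'M[R]_(l, k)) :
  let L := ln m%:R in
  0 < cval -> 0 < cid -> sampling_law delta X S order ->
  (forall a, measurable (GB @^-1` [set a])) ->
  (forall a, measurable (GS @^-1` [set a])) ->
  0 <= delta <= 1 -> (0 < k)%N -> (k <= m)%N -> (k <= n)%N -> 1 <= L ->
  k%:R * L ^+ 2 <= delta * m%:R -> delta * L ^+ 2 <= 1 ->
  l%:R * delta * L <= 2 * k%:R -> (l <= 2 * n)%N ->
  ((1 - 3 * (delta * L ^+ 2))%:E <=
   P [set w | (peak_memory cval cid m (smc_trace sub
    (SMCInput (observed_stream M (rv_mx X w) (S w) (order w))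
       (GB w) (GS w) (Q w))) <=
     36 * (cval + cid) * (k * m + k * n)%:R)%R])%E.
Proof.
move=> L cval0 cid0 law mGB mGS d01 k0 km kn L1 kL dL lL ln2.
have m0 : (0 < m)%N by exact: leq_trans km.
have [mS mo _] := law.
have [mbad Pbad] := arrival_mask_law
  (fun S0 => overloaded delta k l S0) law.
set bad := [set w | _] in mbad Pbad.
set E := [set w | _].
have mE : measurable E by exact: peak_memory_measurable.
apply: (@le_trans _ _ (P (~` bad))).
  rewrite probability_setC // Pbad -EFinB lee_fin lerB //.
  exact: overload_probability.
apply: le_measure; rewrite ?inE //; first exact: measurableC.
move=> w /negP; rewrite /E /= => nbad.
apply: (smc_memory_not_overloaded (delta := delta) (col_perm (order w) (S w)))
  => //=; first by case/andP: d01.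
move=> i j.
by rewrite !mxE; case: ifP => // _; rewrite eqxx.
Qed.

(** What the asymptotic hypotheses are used for, in the form of inequalities
    holding eventually, together with the error term [delta * log(m)^2], which
    bounds the failure probability up to a constant. *)
Lemma smc_memory_asymptotics {R : realType} {m n k l : nat -> nat}
    {delta : nat -> R} :
  m @ \oo --> \oo ->
  (\forall s \near \oo, (1 <= k s <= minn (m s) (n s))%N) ->
  (forall s, 0 <= delta s <= 1) ->
  (fun s => (k s)%:R * Num.max (1 / (n s)%:R) (ln (m s)%:R ^+ 2 / (m s)%:R) : R^o)
    =o_\oo (delta : nat -> R^o) ->
  (delta : nat -> R^o) =o_\oo (fun s => 1 / ln (m s)%:R ^+ 2 : R^o) ->
  (\forall s \near \oo,
     `|(l s)%:R - (k s)%:R / (delta s * ln (m s)%:R)| < 1) ->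
  (\forall s \near \oo,
    [/\ [/\ (0 < k s)%N, (k s <= m s)%N & (k s <= n s)%N], 1 <= ln (m s)%:R :> R,
       (k s)%:R * ln (m s)%:R ^+ 2 <= delta s * (m s)%:R,
       delta s * ln (m s)%:R ^+ 2 <= 1 &
       (l s)%:R * delta s * ln (m s)%:R <= 2 * (k s)%:R /\
       (l s <= 2 * n s)%N]) /\
  delta s * ln (m s)%:R ^+ 2 @[s --> \oo] --> (0 : R).
Proof.
move=> m_oo k_near d01 /eqoP k_delta /eqoP delta_log l_near.
have lnm : \forall s \near \oo, 1 <= ln (m s)%:R :> R.
  have m_ge : \forall s \near \oo, (Num.bound (expR 1 : R) <= m s)%N.
    exact: m_oo _ (nbhs_infty_ge _).
  apply: filterS m_ge => s ms.
  have em : expR 1 <= (m s)%:R :> R.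
    apply: le_trans (ltW (archi_boundP (expR_ge0 1))) _.
    by rewrite ler_nat.
  rewrite -[leLHS]expRK ler_ln // posrE ?expR_gt0 //.
  by apply: lt_le_trans em; exact: expR_gt0.
split; last first.
  apply/cvgr0Pnorm_le => e e0.
  have := delta_log e e0; have := lnm; apply: filterS2 => s L1.
  have L0 : 0 < ln (m s)%:R ^+ 2 :> R.
    by rewrite exprn_gt0 // (lt_le_trans _ L1).
  have -> : `|1 / ln (m s)%:R ^+ 2 : R^o| = (ln (m s)%:R ^+ 2)^-1.
    by rewrite mul1r gtr0_norm // invr_gt0.
  by rewrite ler_pdivlMr // normrM (gtr0_norm L0).
near=> s.
have L1 : 1 <= ln (m s)%:R :> R by near: s.
have /andP[k1 k_mn] : (1 <= k s <= minn (m s) (n s))%N by near: s.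
have l_lt : `|(l s)%:R - (k s)%:R / (delta s * ln (m s)%:R)| < 1 by near: s.
have k_le : `|(k s)%:R * Num.max (1 / (n s)%:R)
                (ln (m s)%:R ^+ 2 / (m s)%:R) : R^o| <= 1 * `|delta s : R^o|.
  by near: s; exact: k_delta.
have delta_le : `|delta s : R^o| <= 1 * `|1 / ln (m s)%:R ^+ 2 : R^o|.
  by near: s; exact: delta_log.
move: (d01 s) k_mn => /andP[d0 _]; rewrite leq_min => /andP[km kn].
move: k_le delta_le l_lt; set L := ln _ in L1 *.
have L0 : 0 < L by exact: lt_le_trans L1.
have L20 : 0 < L ^+ 2 by rewrite exprn_gt0.
have kR : 1 <= (k s)%:R :> R by rewrite ler1n.
have mR : 0 < (m s)%:R :> R by rewrite ltr0n (leq_trans k1).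
have nR : 0 < (n s)%:R :> R by rewrite ltr0n (leq_trans k1).
rewrite !mul1r (ger0_norm d0) [`|(L ^+ 2)^-1 : R^o|]gtr0_norm ?invr_gt0 //.
have max_ge0 : 0 <= Num.max (n s)%:R^-1 (L ^+ 2 / (m s)%:R).
  by rewrite le_max invr_ge0 ler0n.
rewrite (ger0_norm (mulr_ge0 (le_trans ler01 kR) max_ge0)) => k_le delta_le l_lt.
have k_n : (k s)%:R <= delta s * (n s)%:R.
  rewrite -ler_pdivrMr //; apply: le_trans k_le.
  by rewrite ler_wpM2l // le_max lexx.
have k_m : (k s)%:R * L ^+ 2 <= delta s * (m s)%:R.
  rewrite -ler_pdivrMr // -mulrA; apply: le_trans k_le.
  by rewrite ler_wpM2l // le_max lexx orbT.
have dL2 : delta s * L ^+ 2 <= 1 by rewrite -ler_pdivlMr // mul1r.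
have delta0 : 0 < delta s.
  by rewrite -(pmulr_lgt0 _ mR) (lt_le_trans _ k_m) // mulr_gt0 // (lt_le_trans _ kR).
have dL0 : 0 < delta s * L by rewrite mulr_gt0.
have dL1 : delta s * L <= 1.
  by apply: le_trans dL2; rewrite ler_wpM2l // expr2 -[leLHS]mulr1 ler_pM2l.
(* Rounding costs at most 1, which is absorbed since [delta * L <= 1 <= k]. *)
have lL : (l s)%:R * delta s * L <= 2 * (k s)%:R.
  move: (ltW (le_lt_trans (ler_norm _) l_lt)).
  rewrite lerBlDl -(ler_pM2r dL0) mulrDl mul1r divfK ?gt_eqF // mulrA => /le_trans.
  by apply; rewrite mulr_natl mulr2n lerD2l (le_trans dL1).
split => //; split => //.
rewrite -(ler_nat R) natrM.
have : 0 <= (l s)%:R :> R by [].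
have : (l s)%:R * (delta s * L) <= 2 * (delta s * (n s)%:R).
  by rewrite mulrA (le_trans lL) // ler_pM2l.
rewrite mulrCA [leRHS]mulrCA ler_pM2l // => lL2n l0.
by apply: le_trans lL2n; rewrite -[leLHS]mulr1 ler_wpM2l.
Unshelve. all: by end_near.
Qed.

Theorem theorem6 (R : realType) (cval cid : R) (sub : subroutines R)
  (m n k l : nat -> nat) (delta : nat -> R)
  (M : forall s, 'M[R]_(m s, n s))
  (d : nat -> measure_display) (T : forall s, measurableType (d s))
  (P : forall s, probability (T s) R)
  (X : forall s, 'I_(m s) -> 'I_(n s) -> {RV (P s) >-> R})
  (S : forall s, T s -> 'M[bool]_(m s, n s))
  (order : forall s, T s -> 'S_(n s))
  (GB : forall s, T s -> 'M[{set 'I_4}]_(m s, l s))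
  (GS : forall s, T s -> 'M[{set 'I_4}]_(m s, n s))
  (Q : forall s, 'I_(l s) -> 'I_(k s) -> {RV (P s) >-> R}) :
  let input s (w : T s) : smc_input R (m s) (n s) (l s) (k s) :=
    SMCInput (observed_stream (M s) (rv_mx (X s) w) (S s w) (order s w))
      (GB s w) (GS s w) (rv_mx (Q s) w) in
  0 < cval -> 0 < cid ->
  subroutines_correct sub ->
  (* m and n tend to infinity *)
  m @ \oo --> \oo -> n @ \oo --> \oo ->
  (* the random model *)
  (forall s i j, 0 <= M s i j <= 1) ->
  (forall s, 0 <= delta s <= 1) ->
  (forall s, noise_model (M s) (X s)) ->
  (forall s, sampling_law (delta s) (X s) (S s) (order s)) ->
  (forall s, split_law (X s) (S s) (order s)
               (fun w => smc_density (input s w)) (GB s) (GS s)) ->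
  (forall s w, (k s <= l s)%N -> orthonormal_cols (rv_mx (Q s) w)) ->
  (* (i) *)
  (fun s => frobenius_sq (M s) : R^o)
    =Theta_\oo (fun s => (m s * n s)%:R : R^o) ->
  (* (ii) *)
  smallest_spectral_cut M k ->
  (* (iii) *)
  (fun s => (k s)%:R * Num.max (1 / (n s)%:R) (ln (m s)%:R ^+ 2 / (m s)%:R) : R^o)
    =o_\oo (delta : nat -> R^o) ->
  (delta : nat -> R^o) =o_\oo (fun s => 1 / ln (m s)%:R ^+ 2 : R^o) ->
  (* l is k / (delta log m), up to rounding to an integer *)
  (\forall s \near \oo,
     `|(l s)%:R - (k s)%:R / (delta s * ln (m s)%:R)| < 1) ->
  (* the memory is O(km + kn) with high probability *)
  exists C : R,
    P s [set w | peak_memory cval cid (m s) (smc_trace sub (input s w))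
                 <= C * (k s * m s + k s * n s)%:R] @[s --> \oo] --> 1%E.
Proof.
move=> input cval0 cid0 _ m_oo _ _ d01 _ law split_l _ _ [[k_near _ _] _]
  k_delta delta_log l_near.
have [eventually dL_cvg] :=
  smc_memory_asymptotics m_oo k_near d01 k_delta delta_log l_near.
exists (36 * (cval + cid)).
apply: (@squeeze_cvge _ _ _ _
  (fun s => (1 - 3 * (delta s * ln (m s)%:R ^+ 2))%:E) _ (fun=> 1%E)).
- apply: filterS eventually => s [[k0 km kn] L1 kL dL [lL ln2]].
  have [mGB mGS _] := split_l s.
  rewrite probability_le1 ?andbT.
    exact: smc_memory_probability.
  have [mS mo _] := law s.
  exact: peak_memory_measurable.
- apply: cvg_EFin; first by apply: nearW.
  rewrite -[X in _ --> X]subr0 -[X in _ - X](mulr0 3).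
  by apply: cvgB; [exact: cvg_cst|apply: cvgMr].
- exact: cvg_cst.
Qed.
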